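(* Let $0<\alpha$, $0<\beta$ with $\alpha+\beta\le\tfrac12$, $Z>0$ and $p_1\in[0,1]$, and put $\delta=\frac{1}{1-\alpha p_1}$, $t_1=\delta\tau_0$ (the duration of the first epoch under the attack). Under the Pay-Per-Share (PPS) scheme, if the adversary conducts a classical block withholding (BWH) attack against a victim pool with fraction $p_1$ of its power from $t=0$ onwards, then after the first epoch, for all $x\ge0$, the revenue changes of the adversary, of the honest members of the victim pool and of the remaining honest miners are $$\Delta_A(t_1+x)=\frac{\alpha x}{\tau_0}\big(\delta(1-p_12^{-Z})-1\big)-\alpha\delta p_12^{-Z}$$ (which is $\approx\frac{\alpha x}{\tau_0}(\delta-1)$ when terms proportional to $2^{-Z}\ll1$ are neglected), $$\Delta_{H_P}(t_1+x)=\frac{\beta x}{\tau_0}(\delta-1),\qquad \Delta_{H_R}(t_1+x)=\frac{(1-\alpha-\beta)x}{\tau_0}(\delta-1),$$ whereas the revenue change of the pool operator is $$\Delta_{Po}(t_1+x)=-\Big(1+\frac{x}{\tau_0}\Big)\alpha\delta p_1(1-2^{-Z}).$$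
   Context: Model (all revenues, rates and epoch durations are expected values and are treated deterministically). The total network hashpower is normalized to $1$. The adversary ($A$) controls a fraction $\alpha$; the honest members of a victim pool ($H_P$) control $\beta$; the remaining honest miners ($H_R$) control $1-\alpha-\beta$. An epoch is the time needed to accumulate $D_0$ blocks on the chain; each block has coinbase reward $R_b=1/D_0$, so the total coinbase reward of an epoch is $1$. There are no forks: every published block is on the chain. At relative block difficulty $d$ (with $d=1$ for the epoch starting at $t=0$), hashpower $h$ finds full proofs-of-work (valid blocks, fPoW) at rate $hD_0/(d\tau_0)$, where $\tau_0$ is the target epoch duration; thus if everyone mines honestly at $d=1$, an epoch lasts $\tau_0$. At the end of an epoch of actual duration $\tau$, the difficulty is multiplied by $\tau_0/\tau$ (difficulty adjustment). PPS pool with fixed gap $Z$: the pool's share difficulty is always $2^{-Z}$ times the current block difficulty (so it is adjusted together with it). Hence hashpower $h$ finds valid shares at $2^{Z}$ times the rate at which it finds fPoWs, and a fraction $2^{-Z}$ of the shares are fPoWs. The pool operator ($Po$) immediately pays $R_b\cdot\frac{\text{share difficulty}}{\text{block difficulty}}=R_b2^{-Z}$ for every submitted share (whether or not it is an fPoW) and collects the coinbase reward of every block submitted to the pool. Pool fees are neglected. Attack: before $t=0$ everyone mines honestly. From $t=0$ on, the adversary uses hashpower $\alpha p_1$ in the victim pool, submitting all shares that are not fPoWs and never submitting (discarding, and not being paid for) any fPoW; it uses hashpower $\alpha(1-p_1)$ for honest solo mining, keeping the coinbase rewards. Honest pool members submit all their shares, including fPoWs; the remaining honest miners keep the coinbase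 rewards of the blocks they find. Revenue change: for each entity $x$, $\Delta_x(t)$ is its total revenue over $[0,t]$ under the attack minus its total revenue over $[0,t]$ without attack. Without attack, a mining entity with hashpower fraction $f_x$ earns $f_x t/\tau_0$ and the pool operator has net revenue $0$. The operator's revenue is coinbase rewards collected minus PPS payments made. *)

(* Defs.v *)
From Stdlib Require Import Reals ClassicalEpsilon.
From Coquelicot Require Import Coquelicot.
Open Scope R_scope.

(** Conventions: Stdlib's reals, with Coquelicot's Riemann integral.  All
    quantities are deterministic expected values, the total hashpower is 1, and
    difficulties are relative to the block difficulty of the epoch that starts
    at time 0. *)

Record setting := Setting {
  adv_power : R;       (** hashpower of the adversary *)
  pool_power : R;      (** hashpower of the honest members of the victim pool *)
  bwh_fraction : R;    (** fraction of the adversary's power withholding blocks *)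
  target_time : R;     (** target duration of an epoch *)
  epoch_blocks : nat   (** number of blocks on the chain that make up an epoch *)
}.

Definition infiltrating_power (N : setting) : R := adv_power N * bwh_fraction N.
Definition solo_power (N : setting) : R := adv_power N * (1 - bwh_fraction N).
Definition rest_power (N : setting) : R := 1 - adv_power N - pool_power N.

Definition block_reward (N : setting) : R := 1 / INR (epoch_blocks N).

(** Rate at which hashpower [h] finds full proofs-of-work at difficulty [d]. *)
Definition fpow_rate (N : setting) (h d : R) : R :=
  h * INR (epoch_blocks N) / (d * target_time N).

(** The full proofs-of-work found by [infiltrating_power] are discarded; all
    others are published, and there are no forks. *)
Definition chain_rate (N : setting) (d : R) : R :=
  fpow_rate N (solo_power N) d + fpow_rate N (pool_power N) d
  + fpow_rate N (rest_power N) d.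

Definition epoch_duration (N : setting) (d : R) : R :=
  INR (epoch_blocks N) / chain_rate N d.

Fixpoint difficulty (N : setting) (k : nat) : R :=
  match k with
  | O => 1
  | S k' => difficulty N k' *
             (target_time N / epoch_duration N (difficulty N k'))
  end.

Fixpoint epoch_start (N : setting) (k : nat) : R :=
  match k with
  | O => 0
  | S k' => epoch_start N k' + epoch_duration N (difficulty N k')
  end.

(** The index of the epoch in progress at time [t]; unspecified for [t < 0]. *)
Definition epoch_at (N : setting) (t : R) : nat :=
  epsilon (inhabits O)
    (fun k => epoch_start N k <= t < epoch_start N (S k)).

Definition difficulty_at (N : setting) (t : R) : R :=
  difficulty N (epoch_at N t).

(** The gap [Z] enters only through the pool: the shares of the pool have
    difficulty [2^(-Z)] times the current block difficulty. *)
Definition share_difficulty (Z d : R) : R := Rpower 2 (- Z) * d.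

(** Shares include those that happen to be full proofs-of-work. *)
Definition share_rate (N : setting) (Z h d : R) : R :=
  Rpower 2 Z * fpow_rate N h d.

Definition pps_payment (N : setting) (Z d : R) : R :=
  block_reward N * (share_difficulty Z d / d).

Definition adv_submission_rate (N : setting) (Z d : R) : R :=
  share_rate N Z (infiltrating_power N) d - fpow_rate N (infiltrating_power N) d.

Definition honest_submission_rate (N : setting) (Z d : R) : R :=
  share_rate N Z (pool_power N) d.

Inductive entity := Adversary | HonestPool | HonestRest | Operator.

Definition revenue_rate (N : setting) (Z : R) (e : entity) (d : R) : R :=
  match e with
  | Adversary =>
      pps_payment N Z d * adv_submission_rate N Z d
      + block_reward N * fpow_rate N (solo_power N) d
  | HonestPool => pps_payment N Z d * honest_submission_rate N Z d
  | HonestRest => block_reward N * fpow_rate N (rest_power N) d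
  | Operator =>
      block_reward N * fpow_rate N (pool_power N) d
      - pps_payment N Z d *
        (adv_submission_rate N Z d + honest_submission_rate N Z d)
  end.

Definition revenue_attack (N : setting) (Z : R) (e : entity) (t : R) : R :=
  RInt (fun s => revenue_rate N Z e (difficulty_at N s)) 0 t.

Definition revenue_honest (N : setting) (e : entity) (t : R) : R :=
  match e with
  | Adversary => adv_power N * t / target_time N
  | HonestPool => pool_power N * t / target_time N
  | HonestRest => rest_power N * t / target_time N
  | Operator => 0
  end.

Definition revenue_change (N : setting) (Z : R) (e : entity) (t : R) : R :=
  revenue_attack N Z e t - revenue_honest N e t.

(* Main.v *)
(** Withholding slows the chain by the factor [1 - alpha p1], so the first epoch
    lasts [delta tau0]; a single difficulty adjustment compensates exactly, and
    every later epoch has difficulty [1 / delta] and duration [tau0].  Each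
    entity earns at a rate [w / (d tau0)] with a weight [w] that does not depend
    on the difficulty [d], hence [w delta] during the first epoch and
    [w delta x / tau0] during the time [x] that follows it. *)

Require Import Defs.
From Stdlib Require Import Reals ClassicalEpsilon Lra.
From Coquelicot Require Import Coquelicot.
Open Scope R_scope.

(** Positivity behind every division below; the last conjunct makes the chain grow. *)
Definition well_formed (N : setting) : Prop :=
  0 < target_time N /\ (0 < epoch_blocks N)%nat /\ infiltrating_power N < 1.

(** The reciprocal of [delta] in the theorem. *)
Definition publishing_power (N : setting) : R := 1 - infiltrating_power N.

Lemma epoch_duration_eq (N : setting) (d : R) :
  well_formed N -> 0 < d ->
  epoch_duration N d = d * target_time N / publishing_power N.
Proof.
  intros [Ht [Hb Hi]] Hd; apply lt_0_INR in Hb.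
  unfold epoch_duration, chain_rate, fpow_rate, publishing_power, rest_power,
    solo_power, infiltrating_power in *.
  field; repeat split; try lra.
  (* The side condition left by [field] is that the block rate, cleared of denominators, is nonzero;
     the pool's power cancels in it. *)
  replace (_ + _ + _)
    with ((1 - adv_power N * bwh_fraction N) * INR (epoch_blocks N)) by ring.
  apply Rmult_integral_contrapositive; split; lra.
Qed.

(** An epoch's duration is proportional to its difficulty, so the old difficulty cancels in the
    adjustment. The induction only carries positivity. *)
Lemma difficulty_succ (N : setting) (k : nat) :
  well_formed N -> difficulty N (S k) = publishing_power N.
Proof.
  intros Hwf.
  assert (Hg : 0 < publishing_power N)
    by (destruct Hwf as [_ [_ Hi]]; unfold publishing_power; lra).
  assert (Hstep : forall j, 0 < difficulty N j ->
    difficulty N (S j) = publishing_power N).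
  { intros j Hj; simpl; rewrite epoch_duration_eq by assumption.
    destruct Hwf as [Ht _]; field; lra. }
  induction k as [|k IH]; apply Hstep; [simpl; lra | now rewrite IH].
Qed.

Lemma epoch_start_succ (N : setting) (k : nat) :
  well_formed N ->
  epoch_start N (S k)
    = target_time N / publishing_power N + INR k * target_time N.
Proof.
  intros Hwf.
  assert (Hg : 0 < publishing_power N)
    by (destruct Hwf as [_ [_ Hi]]; unfold publishing_power; lra).
  induction k as [|k IH].
  - simpl; rewrite epoch_duration_eq by (assumption || lra); field; lra.
  - change (epoch_start N (S (S k)))
      with (epoch_start N (S k) + epoch_duration N (difficulty N (S k))).
    rewrite IH, difficulty_succ, epoch_duration_eq, S_INR by assumption.
    field; lra.
Qed.

Lemma epoch_at_spec (N : setting) (t : R) :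
  well_formed N -> 0 <= t ->
  epoch_start N (epoch_at N t) <= t < epoch_start N (S (epoch_at N t)).
Proof.
  intros Hwf Ht; unfold epoch_at; apply epsilon_spec.
  assert (Htau : 0 < target_time N) by apply Hwf.
  destruct (Rlt_or_le t (epoch_start N 1)) as [Hlt | Hle].
  - exists O; split; [exact Ht | exact Hlt].
  - rewrite epoch_start_succ in Hle by assumption; simpl in Hle.
    set (s := target_time N / publishing_power N) in *.
    destruct (nfloor_ex ((t - s) / target_time N)) as [k [Hk1 Hk2]].
    { apply Rle_div_r; lra. }
    apply Rle_div_r in Hk1; [| exact Htau].
    apply Rlt_div_l in Hk2; [| exact Htau].
    (* [k] counts the complete epochs of length [target_time N] since [s]; the successor accounts
       for the longer first epoch, which has index 0. *)
    exists (S k); rewrite !epoch_start_succ, S_INR by assumption.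
    fold s; lra.
Qed.

Lemma difficulty_at_first_epoch (N : setting) (t : R) :
  well_formed N -> 0 <= t < target_time N / publishing_power N ->
  difficulty_at N t = 1.
Proof.
  intros Hwf [Ht1 Ht2]; unfold difficulty_at.
  destruct (epoch_at_spec N t Hwf Ht1) as [Hs _].
  destruct (epoch_at N t) as [|k]; [reflexivity |].
  rewrite epoch_start_succ in Hs by assumption.
  assert (0 <= INR k * target_time N).
  { apply Rmult_le_pos; [apply pos_INR | apply Rlt_le, Hwf]. }
  lra.
Qed.

Lemma difficulty_at_later_epochs (N : setting) (t : R) :
  well_formed N -> 0 <= t -> target_time N / publishing_power N <= t ->
  difficulty_at N t = publishing_power N.
Proof.
  intros Hwf Ht1 Ht2; unfold difficulty_at.
  destruct (epoch_at_spec N t Hwf Ht1) as [_ Hs].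
  destruct (epoch_at N t) as [|k]; [| now apply difficulty_succ].
  rewrite epoch_start_succ in Hs by assumption; simpl in Hs; lra.
Qed.

(** For the adversary, paid shares [alpha p1 (1 - 2^(-Z))] and solo mining [alpha (1 - p1)] are
    added up. For the operator, the coinbase of the pool's blocks offsets the pay of the honest
    members, leaving only the pay of the adversary. *)
Definition revenue_weight (N : setting) (Z : R) (e : entity) : R :=
  match e with
  | Adversary => adv_power N * (1 - bwh_fraction N * Rpower 2 (- Z))
  | HonestPool => pool_power N
  | HonestRest => rest_power N
  | Operator => - infiltrating_power N * (1 - Rpower 2 (- Z))
  end.

Lemma revenue_rate_eq (N : setting) (Z : R) (e : entity) (d : R) :
  well_formed N -> 0 < d ->
  revenue_rate N Z e d = revenue_weight N Z e / (d * target_time N).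
Proof.
  intros [Ht [Hb _]] Hd; apply lt_0_INR in Hb.
  assert (HZ : 0 < Rpower 2 Z) by apply exp_pos.
  destruct e; unfold revenue_rate, revenue_weight, pps_payment,
    adv_submission_rate, honest_submission_rate, share_rate, share_difficulty,
    block_reward, fpow_rate, solo_power, infiltrating_power;
    (* With [2^(-Z)] written as the inverse of [2^Z], [field] cancels the share frequency against
       the share payment, and the block count against the block reward. *)
    rewrite ?Rpower_Ropp; field; repeat split; lra.
Qed.

(** The integrand is constant on each side of the end of the first epoch, since all later epochs
    share one difficulty. *)
Lemma revenue_attack_eq (N : setting) (Z : R) (e : entity) (x : R) :
  well_formed N -> 0 <= x ->
  revenue_attack N Z e (target_time N / publishing_power N + x)
    = revenue_weight N Z e / publishing_power N * (1 + x / target_time N).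
Proof.
  intros Hwf Hx.
  assert (Htau : 0 < target_time N) by apply Hwf.
  assert (Hg : 0 < publishing_power N)
    by (destruct Hwf as [_ [_ Hi]]; unfold publishing_power; lra).
  assert (Ht1 : 0 < target_time N / publishing_power N)
    by now apply Rdiv_lt_0_compat.
  unfold revenue_attack; apply is_RInt_unique.
  set (t1 := target_time N / publishing_power N) in *.
  set (w := revenue_weight N Z e).
  assert (Hfirst : is_RInt (fun s => revenue_rate N Z e (difficulty_at N s)) 0 t1
    (scal (t1 - 0) (w / (1 * target_time N)))).
  { apply is_RInt_ext with (fun _ => w / (1 * target_time N));
      [| apply @is_RInt_const].
    intros s; rewrite Rmin_left, Rmax_right by lra; intros Hs.
    rewrite difficulty_at_first_epoch by (assumption || fold t1; lra).
    symmetry; apply revenue_rate_eq; [assumption | lra]. }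
  assert (Hlater : is_RInt (fun s => revenue_rate N Z e (difficulty_at N s))
    t1 (t1 + x)
    (scal (t1 + x - t1) (w / (publishing_power N * target_time N)))).
  { apply is_RInt_ext with (fun _ => w / (publishing_power N * target_time N));
      [| apply @is_RInt_const].
    intros s; rewrite Rmin_left, Rmax_right by lra; intros Hs.
    rewrite difficulty_at_later_epochs by (assumption || fold t1; lra).
    symmetry; apply revenue_rate_eq; assumption. }
  replace (w / publishing_power N * (1 + x / target_time N)) with
    (plus (scal (t1 - 0) (w / (1 * target_time N)))
       (scal (t1 + x - t1) (w / (publishing_power N * target_time N)))).
  - exact (is_RInt_Chasles _ _ _ _ _ _ Hfirst Hlater).
  - unfold plus, scal, t1; simpl; unfold mult; simpl; field; lra.
Qed.

Theorem corollary1 (alpha beta p1 tau0 Z : R) (D0 : nat)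
  (halpha : 0 < alpha) (hbeta : 0 < beta) (hab : alpha + beta <= 1 / 2)
  (hp1 : 0 <= p1 <= 1) (htau0 : 0 < tau0) (hD0 : (0 < D0)%nat) (hZ : 0 < Z) :
  let N := Setting alpha beta p1 tau0 D0 in
  let delta := 1 / (1 - alpha * p1) in
  let t1 := delta * tau0 in
  epoch_duration N (difficulty N 0) = t1 /\
  forall x : R, 0 <= x ->
    revenue_change N Z Adversary (t1 + x)
      = alpha * x / tau0 * (delta * (1 - p1 * Rpower 2 (- Z)) - 1)
        - alpha * delta * p1 * Rpower 2 (- Z) /\
    (exists c : R, forall Z' : R, 0 < Z' ->
       revenue_change N Z' Adversary (t1 + x)
         = alpha * x / tau0 * (delta - 1) + c * Rpower 2 (- Z')) /\
    revenue_change N Z HonestPool (t1 + x)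
      = beta * x / tau0 * (delta - 1) /\
    revenue_change N Z HonestRest (t1 + x)
      = (1 - alpha - beta) * x / tau0 * (delta - 1) /\
    revenue_change N Z Operator (t1 + x)
      = - (1 + x / tau0) * alpha * delta * p1 * (1 - Rpower 2 (- Z)).
Proof.
  intros N delta t1.
  assert (Hp : alpha * p1 < 1).
  { assert (alpha * p1 <= alpha * 1) by (apply Rmult_le_compat_l; lra); lra. }
  assert (Hwf : well_formed N) by (repeat split; assumption).
  assert (Ht1 : t1 = target_time N / publishing_power N).
  { unfold t1, delta, publishing_power, infiltrating_power; simpl; field; lra. }
  split.
  { simpl difficulty; rewrite epoch_duration_eq, Ht1 by (assumption || lra).
    unfold Rdiv; ring. }
  intros x Hx.
  assert (Hchange : forall z e, revenue_change N z e (t1 + x)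
    = revenue_weight N z e * delta * (1 + x / tau0)
      - revenue_honest N e (t1 + x)).
  { intros z e; unfold revenue_change; rewrite Ht1 at 1.
    rewrite revenue_attack_eq by assumption.
    unfold delta, publishing_power, infiltrating_power; simpl.
    field; lra. }
  (* The witness collects both multiples of [2^(-Z')] in the adversary's exact revenue change, from
     the first epoch and from the time [x] after it. *)
  repeat split; [| exists (- alpha * p1 * delta * (1 + x / tau0)); intros Z' _
    | | |]; rewrite Hchange; unfold t1; simpl;
    unfold rest_power, infiltrating_power; simpl; field; lra.
Qed.
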